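(* Let $G$ be a finite group of odd order such that $\Delta(G)$ is triangle-free. Then either (1) $G$ is a $3$-group of exponent $3$, or (2) $G$ is a Frobenius group of order $3\cdot 7^a$ for a positive integer $a$, where the Frobenius kernel $N$ has exponent $7$.
   Context: All groups are finite. For a group $G$, the cyclic conjugacy class graph $\Delta(G)$ is the simple undirected graph whose vertices are the nontrivial conjugacy classes of $G$ (the classes $x^G$ with $1\ne x\in G$), where two distinct vertices $x^G$ and $y^G$ are adjacent when there exist $x'\in x^G$ and $y'\in y^G$ such that the subgroup $\langle x',y'\rangle$ is cyclic. A graph is triangle-free if it does not contain three distinct pairwise adjacent vertices. *)

(* Defs.v *)
From mathcomp Require Import all_boot all_fingroup all_solvable.

Set Implicit Arguments.
Unset Strict Implicit.
Unset Printing Implicit Defensive.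

Local Open Scope group_scope.

(* A simple graph is a symmetric irreflexive relation e on a finite type of
   vertices. *)
Definition triangle_free (V : finType) (e : rel V) : Prop :=
  ~ exists x y z : V,
      [/\ x != y, y != z & x != z] /\ [/\ e x y, e y z & e x z].

Definition nt_classes (gT : finGroupType) (G : {set gT}) : {set {set gT}} :=
  [set x ^: G | x in G^#].

Definition ccc_vertex (gT : finGroupType) (G : {set gT}) : finType :=
  {C : {set gT} | C \in nt_classes G}.

Definition ccc_graph (gT : finGroupType) (G : {set gT}) : rel (ccc_vertex G) :=
  fun C D => (C != D) &&
    [exists x in val C, [exists y in val D, cyclic <<[set x; y]>>]].

Lemma ccc_graph_sym (gT : finGroupType) (G : {set gT}) :
  symmetric (@ccc_graph gT G).
Proof.
move=> C D; rewrite /ccc_graph eq_sym; congr (_ && _).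
by apply/existsP/existsP => -[x /andP[Cx /existsP[y /andP[Dy cxy]]]];
  exists y; rewrite Dy; apply/existsP; exists x; rewrite Cx setUC.
Qed.

Lemma ccc_graph_irr (gT : finGroupType) (G : {set gT}) :
  irreflexive (@ccc_graph gT G).
Proof. by move=> C; rewrite /ccc_graph eqxx. Qed.

Arguments ccc_graph {gT} G%_g.

(* Main.v *)
Require Import Defs.
From mathcomp Require Import all_boot all_fingroup all_solvable.
From mathcomp Require Import ssralg finmodule integral_char.

(* A nontrivial element x of an odd order group is not conjugate to x^-1, so in
   a triangle-free graph every nontrivial power of x is conjugate to x or x^-1.
   Hence x has prime order p, and if p > 3 some element of prime order (p - 1)/2
   normalizes <x>; by induction p is 3 or 7, and G is solvable by Burnside.  Let
   V be a minimal normal subgroup.  If every element of the coset VnX has cube 1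
   and X has no nontrivial fixed point on V, then v^|X| = 1 for all v in V.  With
   X of order 7 this excludes the case where V is a 3-group and G has elements
   of order 7; with X of order 3 it shows that the Sylow 3-subgroups have order 3
   when V is a 7-group.  Then G / O_3'(G) has order 3, because in it an element
   of order 7 would act regularly on a normal subgroup of order 3. *)

Set Implicit Arguments.
Unset Strict Implicit.
Unset Printing Implicit Defensive.

Import FiniteModule.
Local Open Scope group_scope.

(** * Conjugate and commuting elements *)

Definition prime_orders (gT : finGroupType) (G : {set gT}) :=
  {in G^#, forall x, prime #[x]}.

Definition powers_fuse (gT : finGroupType) (G : {set gT}) :=
  forall x y : gT, x \in G -> y \in <[x]>^# ->
    (y \in x ^: G) || (y^-1 \in x ^: G).

Definition orders37 (gT : finGroupType) (G : {set gT}) :=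
  {in G^#, forall x, #[x] = 3 \/ #[x] = 7}.

(** The square of [g] centralizes [x]. As [G] has odd order, [g] is a power of [g ^+ 2], so [x]
    equals its own inverse and is trivial, again by oddness. *)
Lemma odd_conjg_inv (gT : finGroupType) (G : {group gT}) (x g : gT) :
  odd #|G| -> x \in G -> g \in G -> x ^ g = x^-1 -> x = 1.
Proof.
move=> oddG Gx Gg xg.
have co2 : coprime #|G| 2 by rewrite coprimen2.
have cg2 : g ^+ 2 \in 'C[x].
  by apply/cent1P/commute_sym/commgP/conjg_fixP; rewrite conjgM xg conjVg xg invgK.
have cxg : x ^ g = x.
  apply/conjg_fixP/commgP/commute_sym/cent1P.
  by rewrite -(expgK co2 Gg) groupX.
by rewrite -(expgK co2 Gx) expgS expg1 -{2}cxg xg mulgV expg1n.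
Qed.

(** Commuting elements of distinct prime orders would have a product of composite order. *)
Lemma prime_orders_commute (gT : finGroupType) (G : {group gT}) (x y : gT) :
    prime_orders G -> x \in G -> y \in G -> x != 1 -> y != 1 ->
  commute x y -> #[x] = #[y].
Proof.
move=> prG Gx Gy ntx nty cxy.
have px : prime #[x] by apply: prG; rewrite !inE ntx.
have py : prime #[y] by apply: prG; rewrite !inE nty.
apply/eqP; apply: contraTT isT => neq.
have co : coprime #[x] #[y] by rewrite prime_coprime // dvdn_prime2.
have oxy := orderM cxy co.
have : prime #[x * y].
  apply: prG; rewrite !inE groupM // andbT -order_gt1 oxy.
  by rewrite (leq_trans (prime_gt1 px)) // leq_pmulr ?prime_gt0.
rewrite oxy => /primeP[_ /(_ #[x] (dvdn_mulr _ (dvdnn _)))].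
by rewrite -{2}(muln1 #[x]) eqn_pmul2l ?prime_gt0 //
  ![_ == 1%N]gtn_eqF ?prime_gt1 // eq_sym gtn_eqF ?prime_gt1.
Qed.

Lemma conjg_iterX (gT : finGroupType) (x g : gT) r k :
  x ^ g = x ^+ r -> x ^ (g ^+ k) = x ^+ (r ^ k).
Proof.
move=> xg; elim: k => [|k IHk]; first by rewrite conjg1.
by rewrite expgSr conjgM IHk conjXg xg -expgM expnS.
Qed.

(** * Cubes in a coset of an abelian subgroup *)

(** Move the factors [y] of [(v * y) ^+ 3] to the right and use [y ^- 2 = y]. For [v] in an abelian
    group normalized by [y], this is a vanishing trace. *)
Lemma cube_norm (gT : finGroupType) (v y : gT) :
  y ^+ 3 = 1 -> (v * y) ^+ 3 = 1 -> v * v ^ y^-1 * v ^ y = 1.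
Proof.
move=> y3 vy3; have yV : y = y^-1 * y^-1.
  by apply: (mulgI (y * y)); rewrite mulgA mulgK mulgV -mulgA.
rewrite -{}vy3 -[RHS]/(v * y * (v * y * (v * y))).
by rewrite !conjgE invgK !mulgA -(mulgA (v * y * v)) -yV.
Qed.

Lemma order3_coset_exponent (gT : finGroupType) (V X : {group gT}) (n : gT) :
    abelian V -> X \subset 'N(V) -> n \in 'N(V) -> 'C_V(X) = 1 ->
    {in V & X, forall v c, (v * (n * c)) ^+ 3 = 1} ->
  {in V, forall v, v ^+ #|X| = 1}.
Proof.
move=> abV nVX nVn cVX cube v Vv.
have nX c : c \in X -> c \in 'N(V) by apply: (subsetP nVX).
have sum0 (u : fmod_of abV) : (\sum_(c in X) u ^@ c = 0)%R.
  apply: val_inj; apply/set1gP; rewrite -cVX inE fmodP /=.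
  apply/centP => d Xd; apply/commgP/conjg_fixP.
  rewrite -fmvalJ ?nX // actr_sum; congr fmval.
  rewrite [RHS](reindex_inj (mulIg d)).
  by apply: eq_big => [c | c Xc]; rewrite ?groupMr // actrM ?nX.
(* Summing v + v^(y^-1) + v^y = 0 over y in nX, the last two sums vanish. *)
pose w := fmod abV v.
have: (\sum_(c in X) (w + w ^@ (n * c)^-1%g + w ^@ (n * c)%g) = 0)%R.
  apply: big1 => c Xc; apply: val_inj.
  have nVnc : n * c \in 'N(V) by rewrite groupM // nX.
  rewrite !fmvalA !fmvalJ ?groupV // fmodK //; apply: cube_norm (cube _ _ Vv Xc).
  by rewrite -(cube _ _ (group1 V) Xc) mul1g.
rewrite !big_split /= GRing.sumr_const.
rewrite [X in (_ + X)%R](_ : _ = 0%R); last first.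
  by rewrite -[RHS](sum0 (w ^@ n)%R); apply: eq_bigr => c Xc; rewrite actrM ?(nX c).
rewrite [X in (_ + X + _)%R](_ : _ = 0%R); last first.
  (* Since [(n * c)^-1 = c^-1 * n^-1], inverting the index gives an orbit sum of [w] followed by the
     action of [n^-1]. *)
  transitivity ((\sum_(c in X) w ^@ c) ^@ n^-1%g)%R; last by rewrite sum0 act0r.
  rewrite actr_sum [RHS](reindex_inj invg_inj).
  apply: eq_big => [c | c Xc]; rewrite ?groupV //.
  by rewrite invMg actrM ?groupV ?(nX c).
by rewrite !GRing.addr0 => w0; rewrite -(fmodK abV Vv) -fmvalZ w0.
Qed.

(** * Fusion of powers and the possible element orders *)

(** Were the order of [x] composite with prime divisor p, the power [x ^+ p] would be nontrivial and
    of smaller order, hence conjugate neither to [x] nor to its inverse. *)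
Lemma powers_fuse_prime_orders (gT : finGroupType) (G : {group gT}) :
  powers_fuse G -> prime_orders G.
Proof.
move=> fuse x /setD1P[ntx Gx].
have p_pr : prime (pdiv #[x]) by rewrite pdiv_prime ?order_gt1.
apply: contraTT isT => npx.
have oxp : #[x ^+ pdiv #[x]] = #[x] %/ pdiv #[x].
  by rewrite orderXdiv ?pdiv_dvd.
have: #[x ^+ pdiv #[x]] = #[x].
  have/(fuse _ _ Gx)/orP[] : x ^+ pdiv #[x] \in <[x]>^#.
  - rewrite !inE mem_cycle andbT -order_eq1 oxp.
    apply: contra npx => /eqP o1.
    by rewrite -[#[x]](divnK (pdiv_dvd _)) o1 mul1n.
  - by case/imsetP => g _ ->; rewrite orderJ.
  by case/imsetP => g _ xg; rewrite -orderV xg orderJ.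
by rewrite oxp => ox; have := ltn_Pdiv (prime_gt1 p_pr) (order_gt0 x); rewrite ox ltnn.
Qed.

(** The classes of [x], [y] and [x^-1] all meet the cyclic group [<[x]>]. Oddness separates those of
    [x] and [x^-1], so if fusion failed the three would form a triangle. *)
Lemma triangle_free_powers_fuse (gT : finGroupType) (G : {group gT}) :
  odd #|G| -> triangle_free (ccc_graph G) -> powers_fuse G.
Proof.
move=> oddG tfG x y Gx /setD1P[nty xy].
have ntx : x != 1 by apply: contraNneq nty => x1; rewrite x1 cycle1 inE in xy.
have Gy : y \in G by apply: subsetP xy; rewrite cycle_subG.
have vP z : z \in G -> z != 1 -> z ^: G \in nt_classes G.
  by move=> Gz ntz; apply/imsetP; exists z; rewrite // !inE ntz.
pose vtx z Gz ntz : ccc_vertex G := exist _ (z ^: G) (vP z Gz ntz).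
have adj z t (Gz : z \in G) (Gt : t \in G) (ntz : z != 1) (ntt : t != 1) :
    z \in <[x]> -> t \in <[x]> -> z ^: G != t ^: G ->
    ccc_graph G (vtx z Gz ntz) (vtx t Gt ntt).
  move=> xz xt neq; rewrite /ccc_graph -val_eqE neq /=.
  apply/existsP; exists z; rewrite class_refl; apply/existsP; exists t.
  rewrite class_refl /=; apply: cyclicS (cycle_cyclic x).
  by rewrite gen_subG; apply/subsetP => u /set2P[] ->.
apply: contraT; rewrite negb_or => /andP[nxy nxVy]; case: tfG.
have GVx : x^-1 \in G by rewrite groupV.
have ntVx : x^-1 != 1 by rewrite invg_eq1.
exists (vtx x Gx ntx), (vtx y Gy nty), (vtx _ GVx ntVx).
have Nxy : x ^: G != y ^: G by apply: contraNneq nxy => ->; apply: class_refl.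
have NyVx : y ^: G != x^-1 ^: G.
  apply: contraNneq nxVy => /class_eqP/imsetP[g Gg ->].
  by rewrite conjVg invgK memJ_class.
have NxVx : x ^: G != x^-1 ^: G.
  apply: contraNneq ntx => /esym/class_eqP/imsetP[g Gg xg].
  by rewrite (odd_conjg_inv oddG Gx Gg).
by rewrite -!val_eqE !adj ?groupV ?cycle_id.
Qed.

(* Fusion makes the square of a generator of Aut <[x]> the conjugation by some
   g ^+ 2 in G; its order is a prime multiple of (#[x] - 1)./2. *)
Lemma powers_fuse_normalizer (gT : finGroupType) (G : {group gT}) (x : gT) :
    odd #|G| -> powers_fuse G -> x \in G -> 3 < #[x] ->
  exists n, [/\ n \in G, #[n] = #[x]./2, x ^ n \in <[x]> & x ^ n != x].
Proof.
move=> oddG fuse Gx o3.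
have prG := powers_fuse_prime_orders fuse.
have ntx : x != 1 by rewrite -order_gt1 (leq_trans _ o3).
have p_pr : prime #[x] by apply: prG; rewrite !inE ntx.
have oddp : odd #[x] by apply: dvdn_odd oddG; apply: order_dvdG.
have /cyclicP[a defA] := Aut_prime_cycle_cyclic p_pr.
have oa : #[a] = #[x].-1.
  by rewrite /order -defA card_Aut_cycle totient_prime.
have Aa : a \in Aut <[x]> by rewrite defA cycle_id.
have aX b k : b \in Aut <[x]> -> b (x ^+ k) = b x ^+ k.
  by move=> Ab; rewrite -!(autmE Ab) morphX ?cycle_id.
have ax_x : a x \in <[x]> by rewrite Aut_closed ?cycle_id.
have ntax : a x != 1.
  rewrite -(autmE Aa) -(morph1 (autm_morphism Aa)).
  by rewrite (inj_in_eq (injmP (injm_autm Aa))) ?cycle_id.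
(* Either [x ^ g = a x] or [x ^ g = (a x)^-1]; the inversion disappears on squaring. *)
have [g Gg agx] : exists2 g, g \in G & x ^ (g ^+ 2) = (a ^+ 2) x.
  have [r axr] := cycleP _ _ ax_x.
  have a2x : (a ^+ 2) x = a x ^+ r by rewrite expgS expg1 permM axr aX // axr.
  have/(fuse _ _ Gx)/orP[] : a x \in <[x]>^# by rewrite !inE ntax.
    case/imsetP=> g Gg axg; exists g => //.
    by rewrite a2x expgS expg1 conjgM -axg axr conjXg -axg axr.
  case/imsetP=> g Gg axg; exists g => //.
  rewrite a2x expgS expg1 conjgM -axg conjVg axr conjXg -axg.
  by rewrite expVgn invgK axr.
have A2 : a ^+ 2 \in Aut <[x]> by rewrite groupX.
have a2x_x : (a ^+ 2) x \in <[x]> by rewrite Aut_closed ?cycle_id.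
have [s a2s] := cycleP _ _ a2x_x.
have iterA k : ((a ^+ 2) ^+ k) x = x ^+ (s ^ k).
  elim: k => [|k IHk]; first by rewrite perm1.
  by rewrite expgSr permM IHk aX // a2s -expgM expnS.
have eqA b : b \in Aut <[x]> -> b x = x -> b = 1.
  move=> Ab bx; apply: (eq_Aut Ab (group1 _)) => _ /cycleP[k ->].
  by rewrite aX // bx perm1.
have gx : x ^ (g ^+ 2) = x ^+ s by rewrite agx a2s.
have predp : #[x].-1 = (#[x]./2 * 2)%N. by rewrite muln2 odd_halfK.
have half_gt1 : 1 < #[x]./2 by rewrite geq_half_double.
have dvdg : #[x]./2 %| #[g ^+ 2].
  have oa2 : #[a ^+ 2] = #[x]./2.
    by rewrite orderXdiv oa predp ?mulnK ?dvdn_mull.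
  rewrite -oa2 order_dvdn; apply/eqP; apply: eqA; first by rewrite groupX.
  by rewrite iterA -(conjg_iterX _ gx) expg_order conjg1.
exists (g ^+ 2); split; rewrite ?groupX ?agx //.
  have ntg : g ^+ 2 != 1.
    by apply: contraTneq dvdg => ->; rewrite order1 dvdn1 neq_ltn half_gt1 orbT.
  have pg : prime #[g ^+ 2] by apply: prG; rewrite !inE ntg groupX.
  by rewrite (prime_nt_dvdP pg _ dvdg) // neq_ltn half_gt1 orbT.
(* If [a ^+ 2] fixed [x], then [#[x] - 1] would divide 2, against [3 < #[x]]. *)
apply/eqP => /(eqA _ A2)/eqP; rewrite -order_dvdn oa predp.
by move/dvdn_leq => /(_ isT); rewrite leqNgt ltn_Pmull.
Qed.

(** Strong induction on p = [#[x]]: for p > 3 the normalizing element [n] has order (p - 1)/2, which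
    is 3 or 7. The first gives p = 7, the second the composite 15. *)
Lemma powers_fuse_orders (gT : finGroupType) (G : {group gT}) (x : gT) :
    odd #|G| -> powers_fuse G -> x \in G -> x != 1 -> #[x] = 3 \/ #[x] = 7.
Proof.
move=> oddG fuse; move: {2}#[x].+1 (ltnSn #[x]) => m.
elim: m x => // m IHm x ltxm Gx ntx.
have prG := powers_fuse_prime_orders fuse.
have p_pr : prime #[x] by apply: prG; rewrite !inE ntx.
have oddp : odd #[x] by apply: dvdn_odd oddG; apply: order_dvdG.
have predp : #[x].-1 = #[x]./2.*2 by rewrite odd_halfK.
have [le3 | gt3] := leqP #[x] 3; first by left; move: oddp p_pr le3; case: #[x] => [|[|[|[]]]].
have [n [Gn on _ ntn]] := powers_fuse_normalizer oddG fuse Gx gt3.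
have n1 : n != 1 by apply: contraNneq ntn => ->; rewrite conjg1.
have [| |] := IHm n _ Gn n1.
- rewrite on -ltnS (leq_trans _ ltxm) // ltnS ltn_half_double -addnn.
  by rewrite -[X in X < _]addn0 ltn_add2l order_gt0.
- by move=> o3; right; rewrite -(prednK (order_gt0 x)) predp -on o3.
by move=> o7; move: p_pr; rewrite -(prednK (order_gt0 x)) predp -on o7.
Qed.

(** * Actions on a normal 3-subgroup or 7-subgroup *)

Lemma prime_orders_pelt (gT : finGroupType) (G V : {group gT}) (p : nat)
    (v : gT) :
    prime_orders G -> V \subset G -> p.-group V -> v \in V -> v != 1 ->
  #[v] = p.
Proof.
move=> prG sVG pV Vv ntv.
have prv : prime #[v] by apply: prG; rewrite !inE ntv (subsetP sVG).
have := pnatP _ (order_gt0 v) (mem_p_elt pV Vv).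
by move/(_ _ prv (dvdnn _))/eqnP.
Qed.

Lemma prime_orders_regular (gT : finGroupType) (G V : {group gT}) (p : nat)
    (x : gT) :
    prime_orders G -> V \subset G -> p.-group V -> x \in G -> x != 1 ->
  #[x] != p -> 'C_V[x] = 1.
Proof.
move=> prG sVG pV Gx ntx oxp; apply/trivgP/subsetP => v /setIP[Vv /cent1P cvx].
rewrite inE; apply: contraNT oxp => ntv; have Gv := subsetP sVG v Vv.
rewrite -(prime_orders_commute prG Gv Gx ntv ntx cvx).
by rewrite (prime_orders_pelt prG sVG pV Vv ntv).
Qed.

Lemma orders37_prime (gT : finGroupType) (G : {set gT}) :
  orders37 G -> prime_orders G.
Proof. by move=> o37 x /o37[] ->. Qed.

(** This reduces the cube condition of [order3_coset_exponent] to ruling out a trivial seventh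
    power. *)
Lemma orders37_cube (gT : finGroupType) (G : {group gT}) (y : gT) :
  orders37 G -> y \in G -> y ^+ 7 != 1 -> y ^+ 3 = 1.
Proof.
move=> o37 Gy y7; have [-> | nty] := eqVneq y 1; first exact: expg1n.
have [o|o] : #[y] = 3 \/ #[y] = 7 by apply: o37; rewrite !inE nty.
  by rewrite -o expg_order.
by rewrite -o expg_order eqxx in y7.
Qed.

(** If [n] moved [x], all elements of the coset of [V] and [<[x]>] through [n] would have cube 1,
    and [order3_coset_exponent] would give [v ^+ 7 = 1] on the 3-group [V]. *)
Lemma normal_3group_cent (gT : finGroupType) (G V : {group gT}) (x n : gT) :
    orders37 G -> abelian V -> V <| G -> V :!=: 1 -> 3.-group V ->
    x \in G -> #[x] = 7 -> n \in G -> #[n] = 3 -> x ^ n \in <[x]> ->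
  x ^ n = x.
Proof.
move=> o37 abV /andP[sVG nVG] ntV V3 Gx x7 Gn n3 /cycleP[r xn].
have prG := orders37_prime o37.
apply/eqP; apply: contraNT ntV => xnx; apply/eqP/trivgP/subsetP => v0 Vv0.
have ntx : x != 1 by rewrite -order_gt1 x7.
have nG := subsetP nVG.
have sXG : <[x]> \subset G by rewrite cycle_subG.
have cVX : 'C_V(<[x]>) = 1.
  by rewrite cent_cycle (prime_orders_regular prG sVG V3) ?x7.
rewrite inE; apply: contraT => ntv0.
have v0_3 := prime_orders_pelt prG sVG V3 Vv0 ntv0.
suff: v0 ^+ 7 = 1 by move/eqP; rewrite -order_dvdn v0_3.
rewrite -x7 orderE (order3_coset_exponent (n := n) abV _ _ cVX) ?nG //.
  exact: subset_trans nVG.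
move=> v _ Vv /cycleP[i ->]; apply: (orders37_cube o37).
  by rewrite !groupM ?groupX // (subsetP sVG).
(* y acts like n on <x> modulo V, so y ^+ 7 = 1 would make n ^+ 7 = n
   centralize x modulo V. *)
apply: contraNneq xnx => y7.
set y := v * _ in y7.
have Gy : y \in G by rewrite !groupM ?groupX // (subsetP sVG).
pose f := coset V.
have Nv : v \in 'N(V) by rewrite nG ?(subsetP sVG).
have [Nx Nn Nxi] : [/\ x \in 'N(V), n \in 'N(V) & x ^+ i \in 'N(V)].
  by rewrite groupX ?nG.
have xnb : f x ^ f n = f x ^+ r by rewrite -morphJ // xn morphX.
have xyb : f x ^ f y = f x ^+ r.
  rewrite /f !morphM ?groupM //= (coset_id Vv) mul1g conjgM xnb.
  apply/conjg_fixP/commgP; rewrite morphX //; exact/commuteX/commute_sym/commuteX.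
have := conjg_iterX 7 xnb; rewrite -(conjg_iterX 7 xyb) -!morphX ?nG //.
rewrite y7 morph1 conjg1 -{1}[7]/(3 + 3 + 1) !expgD expg1 -n3 expg_order !mul1g -morphJ ?nG //.
move/(rcoset_kercosetP (nG _ (groupJ Gx Gn)) (nG _ Gx)); rewrite mem_rcoset => Vc.
(* The quotient [x ^ n * x^-1] now lies in both [V] and [<[x]>], whose orders are coprime. *)
have Xc : x ^ n * x^-1 \in <[x]> by rewrite xn groupM ?groupV ?mem_cycle ?cycle_id.
have: x ^ n * x^-1 \in V :&: <[x]> by apply/setIP.
rewrite coprime_TIg; first by rewrite inE -eq_mulgV1.
by rewrite -[#|<[_]>|]/#[_] x7; apply: (@pnat_coprime 3).
Qed.

(** Take [z] of order 3 in [P]. For [y] in [P] outside [<[z]>], the coset argument with [X = <[z]>]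
    and [n = y] would give [v ^+ 3 = 1] on the 7-group [V]; hence [P = <[z]>]. *)
Lemma card_3subgroup (gT : finGroupType) (G V P : {group gT}) :
    orders37 G -> abelian V -> V <| G -> V :!=: 1 -> 7.-group V ->
    P \subset G -> 3.-group P -> P :!=: 1 -> #|P| = 3.
Proof.
move=> o37 abV /andP[sVG nVG] ntV V7 sPG P3 ntP; have prG := orders37_prime o37.
have ntZ : 'Z(P) != 1 by apply: contraNneq ntP => /(trivg_center_pgroup P3) ->.
have /trivgPn[z /setIP[Pz cPz] ntz] := ntZ.
have z3 := prime_orders_pelt prG sPG P3 Pz ntz.
have nG := subsetP nVG; have Gz := subsetP sPG z Pz.
suff sPZ : P \subset <[z]>.
  by rewrite -z3 orderE; apply/eqP; rewrite eqn_leq !subset_leq_card ?cycle_subG.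
apply/subsetP => y Py.
apply: contraT => nzy; case/trivgPn: ntV => v0 Vv0 ntv0.
have v0_7 := prime_orders_pelt prG sVG V7 Vv0 ntv0.
suff: v0 ^+ 3 = 1 by move/eqP; rewrite -order_dvdn v0_7.
have cVX : 'C_V(<[z]>) = 1.
  by rewrite cent_cycle (prime_orders_regular prG sVG V7) ?z3.
have Gy := subsetP sPG y Py.
rewrite -z3 orderE (order3_coset_exponent (n := y) abV _ _ cVX) ?nG //.
  by rewrite cycle_subG nG.
move=> v c Vv Zc; have Gc : c \in G by apply: subsetP Zc; rewrite cycle_subG.
have Gvyc : v * (y * c) \in G by rewrite !groupM // (subsetP sVG).
apply: (orders37_cube o37) => //; apply: contraNneq nzy => y7.
have Pyc : y * c \in P by rewrite groupM //; apply: subsetP Zc; rewrite cycle_subG.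
have [yc1 | ntyc] := eqVneq (y * c) 1.
  by rewrite -(groupMr _ Zc) yc1 group1.
have yc3 := prime_orders_pelt prG sPG P3 Pyc ntyc.
(* Modulo [V] the seventh power is that of [y * c], which equals [y * c]; so this element of order 3
   would lie in the 7-group [V]. *)
have: coset V (v * (y * c)) ^+ 7 = 1 by rewrite -morphX ?nG // y7 morph1.
rewrite morphM ?nG ?groupM ?(subsetP sVG v) //= (coset_id Vv) mul1g.
rewrite -morphX ?nG ?groupM // -[7]/(3 + 3 + 1) !expgD expg1 -yc3 expg_order !mul1g.
move/coset_idr => /(_ (nG _ (groupM Gy Gc))) Vyc.
by have := prime_orders_pelt prG sVG V7 Vyc ntyc; rewrite yc3.
Qed.

(** * Solvability and the quotient by the 3'-core *)

Lemma orders37_quotient (gT : finGroupType) (G H : {group gT}) :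
  orders37 G -> orders37 (G / H).
Proof.
move=> o37 xb /setD1P[ntxb /morphimP[x Nx Gx xbE]].
have dvd : #[xb] %| #[x] by rewrite xbE morph_order.
have ntx : x != 1 by apply: contraNneq ntxb => x1; rewrite xbE x1 morph1.
have : #[x] = 3 \/ #[x] = 7 by apply: o37; rewrite !inE ntx.
by case=> ox; [left | right]; move: dvd; rewrite ox => /prime_nt_dvdP->; rewrite ?order_eq1.
Qed.

Lemma orders37_prime_divisor (gT : finGroupType) (G : {group gT}) p :
  orders37 G -> prime p -> p %| #|G| -> p = 3 \/ p = 7.
Proof.
move=> o37 p_pr /(Cauchy p_pr)[x Gx ox].
by rewrite -ox in p_pr *; apply: o37; rewrite !inE Gx -order_gt1 prime_gt1.
Qed.

Lemma orders37_solvable (gT : finGroupType) (G : {group gT}) :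
  orders37 G -> solvable G.
Proof.
move=> o37; apply: Burnside_p_a_q_b.
apply: (@uniq_leq_size _ _ [:: 3; 7]); first exact: primes_uniq.
move=> p; rewrite mem_primes => /and3P[p_pr _ /(orders37_prime_divisor o37 p_pr)].
by case=> ->.
Qed.

Lemma orders37_minnormal (gT : finGroupType) (G : {group gT}) :
    orders37 G -> G :!=: 1 ->
  exists V : {group gT},
    [/\ abelian V, V <| G, V :!=: 1 & 3.-group V \/ 7.-group V].
Proof.
move=> o37 ntG; have [V minV sVG] := minnormal_exists ntG (normG G).
have [nVG ntV /is_abelemP[p p_pr abV]] :=
  minnormal_solvable minV sVG (orders37_solvable o37).
exists V; split; rewrite ?/normal ?sVG //; first exact: abelem_abelian abV.
have pV := abelem_pgroup abV.
have [|<-|<-] := orders37_prime_divisor o37 p_pr; [|by left|by right].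
by have [_ pdV _] := pgroup_pdiv pV ntV; apply: dvdn_trans pdV (cardSg sVG).
Qed.

(** The quotient has trivial 3'-core, so its abelian normal subgroup [M] is a 3-group, of order 3 by
    the Sylow bound. An element of order 7 would act regularly on [M], making 7 divide 2; so the
    quotient is itself a 3-group. *)
Lemma card_quotient_core3 (gT : finGroupType) (G : {group gT}) :
  orders37 G -> (#|G|`_3)%N = 3 -> #|G / 'O_3^'(G)| = 3.
Proof.
move=> o37 G3; set N := 'O_3^'(G)%G; have oQ := orders37_quotient (H := N) o37.
have card3 (K : {group coset_of N}) :
    K \subset G / N -> 3.-group K -> K :!=: 1 -> #|K| = 3.
  move=> sKQ K3 ntK; apply/(prime_nt_dvdP (isT : prime 3)); first by rewrite -trivg_card1.
  rewrite -(part_pnat_id K3) -{2}G3 partn_dvd //.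
  exact: dvdn_trans (cardSg sKQ) (dvdn_quotient _ _).
have ntQ : G / N != 1.
  apply/eqP => Q1; have sGN : G \subset N.
    by rewrite -quotient_sub1 ?gFnorm // Q1.
  have := part_p'nat (pgroupS sGN (pcore_pgroup _ G)).
  by rewrite G3.
apply: (card3) => //.
have [M [abM /andP[sMQ nMQ] ntM]] := orders37_minnormal oQ ntQ.
case=> [M3 | M7]; last first.
  case/negP: ntM; rewrite -subG1 -(trivg_pcore_quotient 3^' G).
  by apply: pcore_max; rewrite /normal ?sMQ //; apply: sub_pgroup M7 => q /eqnP->.
have prQ := orders37_prime oQ.
apply/pgroupP => q q_pr qdQ.
have [-> // | q7] := orders37_prime_divisor oQ q_pr qdQ.
have [y Qy oy] := Cauchy q_pr qdQ; rewrite q7 in oy.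
have : #|<[y]>| %| #|M|.-1.
  apply: regular_norm_dvd_pred; first by rewrite cycle_subG (subsetP nMQ).
  move=> t /setD1P[ntt yt].
  have Qt : t \in G / N by apply: subsetP yt; rewrite cycle_subG.
  have y7 : 7.-group <[y]> by rewrite /pgroup -orderE oy.
  have sYQ : <[y]> \subset G / N by rewrite cycle_subG.
  by rewrite (prime_orders_regular prQ sMQ M3) // (prime_orders_pelt prQ sYQ y7 yt ntt).
by rewrite -orderE oy (card3 M).
Qed.

(** * The two cases of the classification *)

Theorem theorem1 (gT : finGroupType) (G : {group gT})
    (ntG : G :!=: 1) (oddG : odd #|G|)
    (tfG : triangle_free (ccc_graph G)) :
  (3.-group G /\ exponent G = 3)
  \/ (exists (a : nat) (N : {group gT}),
        [/\ 0 < a, #|G| = (3 * 7 ^ a)%N, [Frobenius G with kernel N]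
          & exponent N = 7]).
Proof.
have fuse := triangle_free_powers_fuse oddG tfG.
have prG := powers_fuse_prime_orders fuse.
have o37 : orders37 G.
  by move=> x /setD1P[ntx Gx]; apply: powers_fuse_orders fuse _ _.
have expp (p : nat) (H : {group gT}) :
    H \subset G -> p.-group H -> H :!=: 1 -> exponent H = p.
  move=> sHG pH ntH; have [p_pr _ _] := pgroup_pdiv pH ntH.
  apply/(prime_nt_dvdP p_pr); first by rewrite -dvdn1 -trivg_exponent.
  apply/exponentP => x Hx; have [-> | ntx] := eqVneq x 1; first exact: expg1n.
  by rewrite -(prime_orders_pelt prG sHG pH Hx ntx) expg_order.
have [dv7 | ndv7] := boolP (7 %| #|G|); last first.
  have G3 : 3.-group G.
    apply/pgroupP => p p_pr pdG; have [-> // | p7] := orders37_prime_divisor o37 p_pr pdG.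
    by rewrite -p7 pdG in ndv7.
  by left; split; last exact: expp.
right; have [x Gx x7] := Cauchy (isT : prime 7) dv7.
(* This [n] has order (7 - 1)/2 = 3 and normalizes [<[x]>] without centralizing it. It rules out a
   normal 3-group [V] below and makes [P] nontrivial. *)
have [|n [Gn n3 xn nxn]] := powers_fuse_normalizer oddG fuse Gx; first by rewrite x7.
rewrite x7 -[7./2]/3 in n3.
have [P sylP] := Sylow_exists 3 G.
have [sPG P3 _] := and3P sylP.
have ntP : P :!=: 1.
  rewrite -rank_gt0 (rank_Sylow sylP) p_rank_gt0 mem_primes cardG_gt0.
  by rewrite -{2}n3 order_dvdG.
have oP : #|P| = 3.
  have [V [abV nVG ntV [V3|V7]]] := orders37_minnormal o37 ntG.
    by case/eqP: nxn; apply: (normal_3group_cent o37 abV nVG ntV V3 Gx _ Gn _ xn).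
  exact: (card_3subgroup o37 abV nVG ntV V7).
have G3 : (#|G|`_3)%N = 3 by rewrite -(card_Hall sylP).
pose N := 'O_3^'(G)%G.
have nNG : N <| G by apply: pcore_normal.
have sNG := normal_sub nNG.
have oG : #|G| = (3 * #|N|)%N.
  by rewrite mulnC -(card_quotient_core3 o37 G3) card_quotient ?normal_norm // Lagrange.
have N3' : 3^'.-group N by apply: pcore_pgroup.
have N7 : 7.-group N.
  apply/pgroupP => p p_pr pdN.
  have [p3 | -> //] := orders37_prime_divisor o37 p_pr (dvdn_trans pdN (cardSg sNG)).
  by have := pgroupP N3' p p_pr pdN; rewrite p3.
have [a oN] := p_natP N7.
(* For [a = 0] the order of [G] would be 3, which 7 does not divide. *)
have a_gt0 : 0 < a by case: a oN oG => // -> oG; rewrite oG in dv7.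
have ntN : N :!=: 1 by rewrite -cardG_gt1 oN (@ltn_exp2l 7 0).
exists a, N; split => //; [by rewrite oG oN | | exact: expp].
have coNP : coprime #|N| #|P| by rewrite coprime_sym (pnat_coprime P3).
have defG : N ><| P = G.
  rewrite sdprodE ?coprime_TIg // ?(subset_trans sPG) ?normal_norm //.
  apply/eqP; rewrite eqEcard mul_subG //= coprime_cardMg // oP mulnC oG.
  by rewrite leqnn.
(* [P] is the complement: its nontrivial elements have order 3, so they fix no nontrivial element of
   the 7-group [N]. *)
apply: (@FrobeniusWker _ _ P); apply/(Frobenius_semiregularP defG ntN ntP) => y.
move=> /setD1P[nty Py]; apply: (prime_orders_regular prG sNG N7) => //.
  exact: subsetP Py.
by rewrite (prime_orders_pelt prG sPG P3 Py nty).
Qed.
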